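(* Let $X$ be a complete separable metric space, $\mu$ a Radon measure on $X$, $f\colon X\to\mathbb R$ Lipschitz and $\delta\colon X\to(0,\infty)$ Borel. If $\mathcal A$ is a Lipschitz Alberti representation of $\mu$ with $f$-speed $\ge\delta$, then $$D_{\mathcal A}f(x)\ge\delta(x)\,\sigma_{\mathcal A}(x)\quad\text{for }\mu\text{-a.e. }x,$$ where $\sigma_{\mathcal A}$ is an effective speed of $\mathcal A$.
   Context: Derivations: $\operatorname{Lip}_b(X)$ is the algebra of bounded real Lipschitz functions with norm $\max(\|f\|_\infty,\mathbf L(f))$, $\mathbf L(f)$ being the global Lipschitz constant; it is a dual Banach space, and $f_n\to f$ weak* iff $f_n\to f$ pointwise and the $f_n$ are bounded in norm. A derivation is a bounded linear map $D\colon\operatorname{Lip}_b(X)\to L^\infty(\mu)$ with $D(fg)=fDg+gDf$ that is weak* continuous (if $f_n\to f$ weak* then $\int h\,Df_n\,d\mu\to\int h\,Df\,d\mu$ for all $h\in L^1(\mu)$). Derivations are local ($f=g$ on $U$ implies $\chi_UDf=\chi_UDg$), and extend to all Lipschitz $f$ by requiring $\chi_KDf=\chi_KDh$ whenever $K$ is compact and $h\in\operatorname{Lip}_b(X)$ agrees with $f$ on $K$. Fragments: a fragment in $X$ is a bi-Lipschitz map $\gamma\colon K\to X$ with $K=\operatorname{dom}\gamma\subset\mathbb R$ compact of positive Lebesgue measure; $\operatorname{Frag}(X)$ is the set of fragments, topologized by identifying $\gamma$ with its graph in the space of nonempty compact subsets of $\mathbb R\times X$ with the Hausdorff distance. The metric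 differential is $\operatorname{md}\gamma(t)=\lim_{\operatorname{dom}\gamma\ni t'\to t}d(\gamma(t'),\gamma(t))/|t'-t|$; $(f\circ\gamma)'(t)$ is likewise computed along $\operatorname{dom}\gamma$ (both exist for a.e. $t$). Alberti representations: an Alberti representation of $\mu$ is a pair $\mathcal A=(P,\nu)$ where (1) $P$ is a regular Borel probability measure on $\operatorname{Frag}(X)$; (2) $\gamma\mapsto\nu_\gamma$ assigns to each fragment a finite nonnegative Borel measure on $X$, absolutely continuous with respect to the 1-dimensional Hausdorff measure on the image of $\gamma$, and $\gamma\mapsto\int g\,d\nu_\gamma$ is Borel for each $g\in C_c(X)$; (3) $\mu(A)=\int\nu_\gamma(A)\,dP(\gamma)$ for all Borel $A$; (4) for all Borel $A\subset X$ and reals $a\le b$, $\gamma\mapsto\nu_\gamma(A\cap\gamma(\operatorname{dom}\gamma\cap[a,b]))$ is Borel. It is Lipschitz if for some $C$ $P$-a.e. $\gamma$ is $C$-Lipschitz. It has $f$-speed $\ge\delta$ if for $P$-a.e. $\gamma$ and a.e. $t\in\operatorname{dom}\gamma$, $(f\circ\gamma)'(t)\ge\delta(\gamma(t))\operatorname{md}\gamma(t)$. To a Lipschitz Alberti representation one associates the derivation $D_{\mathcal A}$ given by $\int gD_{\mathcal A}f\,d\mu=\int dP(\gamma)\int_X g\,\partial_\gamma f\,d\nu_\gamma$ for bounded Borel $g\in L^1(\mu)$ and $f\in\operatorname{Lip}_b(X)$, where $\partial_\gamma f(x)=(f\circ\gamma)'(\gamma^{-1}(x))$ if $x$ is in the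 image of $\gamma$ and the derivative exists, and $0$ otherwise. Effective speed: $\sigma_{\mathcal A}$ is a Borel representative of the Radon–Nikodym derivative with respect to $\mu$ of the measure $\Sigma_{\mathcal A}=\int_{\operatorname{Frag}(X)}(\operatorname{md}\gamma\circ\gamma^{-1})\,\nu_\gamma\,dP(\gamma)$. *)

(* Defs.v *)
From HB Require Import structures.
From mathcomp Require Import all_boot all_order all_algebra.
From mathcomp Require Import all_classical all_reals all_analysis.
From mathcomp Require Import measurable_realfun.

Set Implicit Arguments.
Unset Strict Implicit.
Unset Printing Implicit Defensive.

Import Order.TTheory GRing.Theory Num.Theory.
Import numFieldNormedType.Exports.

Local Open Scope classical_set_scope.
Local Open Scope ring_scope.

(* As everywhere in the library, complete spaces and measurable spaces carry a
   distinguished point, hence are nonempty. *)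
#[short(type="completeMetricType")]
HB.structure Definition CompleteMetric (R : numDomainType) :=
  { T of CompletePseudoMetric R T & PseudoMetric_isMetric R T }.

Definition separable_space (T : topologicalType) : Prop :=
  exists2 D : set T, countable D & dense D.

Notation borel T := (g_sigma_algebraType (@open T)).

Section radon_regular.
Context {R : realType} {T : ptopologicalType}.
Variable mu : {measure set (borel T) -> \bar R}.
Local Open Scope ereal_scope.

Definition inner_regular : Prop :=
  forall A : set (borel T), measurable A ->
    mu A = ereal_sup [set mu K | K in [set K : set T | compact K /\ K `<=` A]].

Definition outer_regular : Prop :=
  forall A : set (borel T), measurable A ->
    mu A = ereal_inf [set mu U | U in [set U : set T | open U /\ A `<=` U]].

Definition regular : Prop := inner_regular /\ outer_regular.

Definition locally_finite : Prop :=
  forall x : T, exists U : set T, [/\ open U, U x & mu U < +oo].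

Definition radon : Prop := locally_finite /\ inner_regular.

End radon_regular.

Section hausdorff_distance.
Context {R : realType} {T : pseudoMetricType R}.
Implicit Types A B : set T.

Definition in_thickening A B (e : R) : Prop :=
  A `<=` \bigcup_(b in B) ball b e.

Definition hausdorff_dist A B : R :=
  inf [set e : R | [/\ 0 < e, in_thickening A B e & in_thickening B A e]].

End hausdorff_distance.

(* One-dimensional Hausdorff (outer) measure, with the normalisation for which
   it is the Lebesgue measure on the real line. *)
Section hausdorff_measure.
Context {R : realType} {X : metricType R}.
Local Open Scope ereal_scope.

Definition diam (E : set X) : \bar R :=
  ereal_sup (0 |` [set (mdist p.1 p.2)%:E | p in E `*` E]).

Definition hausdorff1_premeasure (d : R) (A : set X) : \bar R :=
  ereal_inf [set \sum_(0 <= k <oo) diam (E k) | E in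
    [set E : (set X)^nat |
      A `<=` \bigcup_k E k /\ forall k, diam (E k) <= d%:E]].

Definition hausdorff1 (A : set X) : \bar R :=
  ereal_sup [set hausdorff1_premeasure d A | d in [set d : R | (0 < d)%R]].

End hausdorff_measure.

Section lipschitz_functions.
Context {R : realType} {X : metricType R}.
Implicit Types f : X -> R.

Definition is_lipschitz (L : R) f : Prop :=
  forall x y, `|f x - f y| <= L * mdist x y.

Definition lipschitz_fun f : Prop := exists L : R, is_lipschitz L f.

Definition lipb f : Prop :=
  (exists M : R, forall x, `|f x| <= M) /\ lipschitz_fun f.

Definition lip_const f : \bar R :=
  ereal_inf [set L%:E | L in [set L : R | 0 <= L /\ is_lipschitz L f]].

Definition sup_norm f : \bar R := ereal_sup (range (fun x => `|f x|%:E)).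

Definition lipb_norm f : \bar R := maxe (sup_norm f) (lip_const f).

(* Weak* convergence of sequences in the dual space of bounded Lipschitz
   functions. *)
Definition lipb_weakstar_cvg (f_ : nat -> X -> R) f : Prop :=
  [/\ forall n, lipb (f_ n), lipb f,
      (forall x, f_ n x @[n --> \oo] --> f x) &
      exists M : R, forall n, (lipb_norm (f_ n) <= M%:E)%E].

End lipschitz_functions.

(* A map D into L^oo(mu) is encoded by a choice of representatives D f, so
   identities in L^oo(mu) become identities mu-almost everywhere; D is only
   constrained on bounded Lipschitz functions. *)
Section derivations.
Context {R : realType} {X : completeMetricType R}.
Variable mu : {measure set (borel X) -> \bar R}.
Implicit Type D : (X -> R) -> (X -> R).

Record is_derivation D : Prop := IsDerivation {
  derivation_Linfty : forall f, lipb f ->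
    (D f : borel X -> R) \in Lfun mu +oo%E ;
  derivation_linear : forall (a : R) f g, lipb f -> lipb g ->
    {ae mu, forall x, D (fun y => a * f y + g y) x = a * D f x + D g x} ;
  derivation_bounded : exists C : R, forall f, lipb f ->
    ('N[mu]_+oo [EFin \o (D f : borel X -> R)] <= C%:E * lipb_norm f)%E ;
  derivation_leibniz : forall f g, lipb f -> lipb g ->
    {ae mu, forall x,
      D (fun y => f y * g y) x = f x * D g x + g x * D f x} ;
  derivation_weakstar : forall (f_ : nat -> X -> R) f,
    lipb_weakstar_cvg f_ f ->
    forall h : borel X -> R, mu.-integrable setT (EFin \o h) ->
      (\int[mu]_x (h x * D (f_ n) x)%:E)%E @[n --> \oo] -->
      (\int[mu]_x (h x * D f x)%:E)%E
}.

(* [u] represents the value at the Lipschitz function [f] of the extension of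
   the derivation [D] to all Lipschitz functions. *)
Definition derivation_extension D (f : X -> R) (u : X -> R) : Prop :=
  measurable_fun setT (u : borel X -> R) /\
  forall (K : set X) (h : X -> R), compact K -> lipb h ->
    {in K, f =1 h} -> {ae mu, forall x, K x -> u x = D h x}.

End derivations.

(* The value outside the domain is fixed, so that a fragment is determined by
   its graph. *)
Record fragment (R : realType) (X : completeMetricType R) := Fragment {
  fdom : set R ;
  frag_fun :> R -> X ;
  fdom_compact : compact fdom ;
  fdom_gt0 : (0 < lebesgue_measure fdom)%E ;
  frag_bilipschitz : exists l L : R, [/\ 0 < l, 0 < L &
    forall s t, fdom s -> fdom t ->
      l * `|s - t| <= mdist (frag_fun s) (frag_fun t) <= L * `|s - t|] ;
  frag_out : forall t, ~ fdom t -> frag_fun t = point }.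

HB.instance Definition _ (R : realType) (X : completeMetricType R) :=
  gen_eqMixin (fragment X).
HB.instance Definition _ (R : realType) (X : completeMetricType R) :=
  gen_choiceMixin (fragment X).

Section fragment_metric.
Context {R : realType} {X : completeMetricType R}.
Implicit Types c : fragment X.

Definition fgraph c : set (R * X) := [set (t, c t) | t in fdom c].

Definition fragment_dist c1 c2 : R := hausdorff_dist (fgraph c1) (fgraph c2).

Lemma fdom_nonempty c : fdom c !=set0.
Proof.
apply/set0P/eqP => c0; have := fdom_gt0 c.
by rewrite c0 measure0 ltxx.
Qed.

Lemma fgraph_bounded c (x0 : R * X) :
  exists2 M : R, 0 < M & fgraph c `<=` ball x0 M.
Proof.
have [M0 cM0] : exists M0 : R, forall t, fdom c t -> `|t| <= M0.
  have [M0 [_ cM0]] := compact_bounded (@fdom_compact _ _ c).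
  exists (M0 + 1) => t ct; apply: (cM0 (M0 + 1)) => //.
  by rewrite ltrDl.
have [l [L [l0 L0 cL]]] := frag_bilipschitz c.
have [s cs] := fdom_nonempty c.
pose M1 := mdist x0.2 (c s) + L * (M0 + `|s|) + 1.
pose M2 := `|x0.1| + M0 + 1.
have M0_ge0 : 0 <= M0 by exact: le_trans (cM0 _ cs).
have M1gt0 : 0 < M1.
  apply: ltr_wpDl => //; apply: addr_ge0; first exact: mdist_ge0.
  by apply: mulr_ge0; [exact: ltW|exact: addr_ge0].
have M2gt0 : 0 < M2 by apply: ltr_wpDl => //; exact: addr_ge0.
exists (Num.max M1 M2); first by rewrite lt_max M1gt0.
move=> _ [t ct <-]; split => /=.
  apply: (@le_ball _ _ _ M2); first by rewrite le_max lexx orbT.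
  rewrite /ball/= (le_lt_trans (ler_normB _ _))// /M2 -addrA ltrD2l.
  by rewrite (le_lt_trans (cM0 _ ct))// ltrDl.
apply: (@le_ball _ _ _ M1); first by rewrite le_max lexx.
rewrite ballEmdist/= (le_lt_trans (metric_triangle _ (c s) _))//.
rewrite /M1 -addrA ltrD2l.
have /andP[_ cst] := cL _ _ cs ct.
rewrite (le_lt_trans cst)// (@le_lt_trans _ _ (L * (M0 + `|s|)))//.
  rewrite ler_pM2l// (le_trans (ler_normB _ _))// addrC lerD2r.
  exact: cM0.
by rewrite ltrDl.
Qed.

Lemma fragment_dist_nonempty c1 c2 :
  [set e : R | [/\ 0 < e, in_thickening (fgraph c1) (fgraph c2) e &
    in_thickening (fgraph c2) (fgraph c1) e]] !=set0.
Proof.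
have [t1 ct1] := fdom_nonempty c1; have [t2 ct2] := fdom_nonempty c2.
have [M1 M10 c1M] := fgraph_bounded c1 (t2, c2 t2).
have [M2 M20 c2M] := fgraph_bounded c2 (t1, c1 t1).
exists (Num.max M1 M2); split.
- by rewrite lt_max M10.
- move=> x /c1M xM; exists (t2, c2 t2); first by exists t2.
  by apply: le_ball xM; rewrite le_max lexx.
- move=> x /c2M xM; exists (t1, c1 t1); first by exists t1.
  by apply: le_ball xM; rewrite le_max lexx orbT.
Qed.

Lemma fragment_dist_has_inf c1 c2 :
  has_inf [set e : R | [/\ 0 < e, in_thickening (fgraph c1) (fgraph c2) e &
    in_thickening (fgraph c2) (fgraph c1) e]].
Proof.
split; first exact: fragment_dist_nonempty.
by exists 0 => e [/ltW].
Qed.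

Lemma fragment_dist_lt c1 c2 (e : R) : fragment_dist c1 c2 < e ->
  in_thickening (fgraph c1) (fgraph c2) e /\
  in_thickening (fgraph c2) (fgraph c1) e.
Proof.
move=> /(inf_lt (fragment_dist_nonempty c1 c2))[d [d0 c12 c21] de].
by split=> x /[dup] cx => [/c12|/c21][y cy yx]; exists y => //;
  apply: le_ball yx; rewrite ltW.
Qed.

Lemma fragment_dist_le c1 c2 (e : R) : 0 < e ->
  in_thickening (fgraph c1) (fgraph c2) e ->
  in_thickening (fgraph c2) (fgraph c1) e -> fragment_dist c1 c2 <= e.
Proof.
move=> e0 c12 c21; apply: ge_inf; last by split.
by case: (fragment_dist_has_inf c1 c2).
Qed.

Lemma fragment_distxx c : fragment_dist c c = 0.
Proof.
apply/eqP; rewrite eq_le; apply/andP; split.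
  apply/ler_addgt0Pl => e e0; rewrite addr0.
  by apply: fragment_dist_le => // x cx; exists x => //; exact: ballxx.
by apply: lb_le_inf; [exact: fragment_dist_nonempty|move=> e [/ltW]].
Qed.

Lemma fragment_dist_sym c1 c2 : fragment_dist c1 c2 = fragment_dist c2 c1.
Proof.
rewrite /fragment_dist /hausdorff_dist; congr inf.
by apply/seteqP; split => e [? ? ?].
Qed.

Lemma fragment_dist_triangle c2 c1 c3 :
  fragment_dist c1 c3 <= fragment_dist c1 c2 + fragment_dist c2 c3.
Proof.
have ge0 c c' : 0 <= fragment_dist c c'.
  by apply: lb_le_inf; [exact: fragment_dist_nonempty|move=> e [/ltW]].
apply/ler_addgt0Pl => e e0.
have e20 : 0 < e / 2 by rewrite divr_gt0.
have [|c12 c21] := @fragment_dist_lt c1 c2 (fragment_dist c1 c2 + e / 2).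
  by rewrite ltrDl.
have [|c23 c32] := @fragment_dist_lt c2 c3 (fragment_dist c2 c3 + e / 2).
  by rewrite ltrDl.
have -> : e + (fragment_dist c1 c2 + fragment_dist c2 c3) =
    (fragment_dist c1 c2 + e / 2) + (fragment_dist c2 c3 + e / 2).
  by rewrite addrACA -splitr addrC.
apply: fragment_dist_le.
- by rewrite addr_gt0// ltr_wpDl.
- move=> x /c12[y /c23[z cz zy] yx]; exists z => //.
  by rewrite addrC; exact: ball_triangle zy yx.
- move=> x /c32[y /c21[z cz zy] yx]; exists z => //.
  exact: ball_triangle zy yx.
Qed.

Lemma fragment_dist0_dom c1 c2 : fragment_dist c1 c2 = 0 ->
  forall t, fdom c1 t -> fdom c2 t /\ c1 t = c2 t.
Proof.
move=> c0 t c1t.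
have near_c2 e : 0 < e -> exists2 s, fdom c2 s &
    ball t e s /\ ball (c1 t) e (c2 s).
  move=> e0; have [|+ _] := @fragment_dist_lt c1 c2 e; first by rewrite c0.
  move=> /(_ (t, c1 t)) [|_ [s c2s <-] [/= st cst]]; first by exists t.
  by exists s => //; split; exact: ball_sym.
have c2t : fdom c2 t.
  have : closed (fdom c2).
    by apply: compact_closed; [exact: Rhausdorff|exact: fdom_compact].
  apply => B /nbhs_ballP[e e0 eB].
  by have [s c2s [ts _]] := near_c2 e e0; exists s; split => //; exact: eB.
split => //; apply: mdist_positivity.
have [l [L [l0 L0 cL]]] := frag_bilipschitz c2.
apply/eqP; rewrite eq_le mdist_ge0 andbT.
apply/ler_addgt0Pl => e e0; rewrite addr0.
pose d := e / (1 + L).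
have d0 : 0 < d by rewrite divr_gt0// addr_gt0.
have [s c2s [ts]] := near_c2 d d0.
rewrite ballEmdist/= => /ltW cts.
rewrite (le_trans (metric_triangle _ (c2 s) _))//.
have /andP[_ cst] := cL _ _ c2s c2t.
have -> : e = d + L * d.
  by rewrite -[X in X + _]mul1r -mulrDl mulrC divfK// gt_eqF// addr_gt0.
apply: lerD => //; apply: (le_trans cst).
by rewrite ler_pM2l// distrC; exact: ltW.
Qed.

Lemma fragment_eq c1 c2 : fdom c1 = fdom c2 -> c1 =1 c2 -> c1 = c2.
Proof.
case: c1 => K1 f1 ? ? ? ?; case: c2 => K2 f2 ? ? ? ? /= K12 /funext f12.
by subst; congr Fragment; exact: Prop_irrelevance.
Qed.

Lemma fragment_dist_positivity c1 c2 : fragment_dist c1 c2 = 0 -> c1 = c2.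
Proof.
move=> c12; have c21 : fragment_dist c2 c1 = 0 by rewrite fragment_dist_sym.
have dom12 : fdom c1 = fdom c2.
  apply/seteqP; split => t ct.
    exact: (fragment_dist0_dom c12 ct).1.
  exact: (fragment_dist0_dom c21 ct).1.
apply: fragment_eq => // t; have [ct|nct] := pselect (fdom c1 t).
  exact: (fragment_dist0_dom c12 ct).2.
by rewrite !frag_out// -dom12.
Qed.

HB.instance Definition _ := @isMetric.Build R (fragment X) fragment_dist
  fragment_distxx fragment_dist_positivity fragment_dist_sym
  fragment_dist_triangle.

End fragment_metric.

(* Frag(X) may be empty, whereas a measurableType must be pointed. *)
Definition fragment_at (R : realType) (X : completeMetricType R)
  (c0 : fragment X) : Type := fragment X.

HB.instance Definition _ (R : realType) (X : completeMetricType R)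
  (c0 : fragment X) := Metric.on (fragment_at c0).
HB.instance Definition _ (R : realType) (X : completeMetricType R)
  (c0 : fragment X) := isPointed.Build (fragment_at c0) c0.

Section fragment_differentials.
Context {R : realType} {X : completeMetricType R}.
Implicit Types (c : fragment X) (f : X -> R).

Definition frag_lipschitz (C : R) c : Prop :=
  forall s t, fdom c s -> fdom c t -> mdist (c s) (c t) <= C * `|s - t|.

Definition frag_image c : set X := c @` fdom c.

Definition frag_inv c (x : X) : R := xget 0 [set t | fdom c t /\ c t = x].

(* The limit of q(t') as t' tends to t along dom c, if t is not isolated in
   dom c and the limit exists, and 0 otherwise. *)
Definition frag_lim c (q : R -> R) (t : R) : R :=
  if `[< limit_point (fdom c) t /\ cvg (q @ within (fdom c) t^') >]
  then lim (q @ within (fdom c) t^') else 0.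

Definition metric_differential c (t : R) : R :=
  frag_lim c (fun t' => mdist (c t') (c t) / `|t' - t|) t.

Definition frag_derive f c (t : R) : R :=
  frag_lim c (fun t' => (f (c t') - f (c t)) / (t' - t)) t.

Definition frag_partial f c (x : X) : R :=
  if `[< frag_image c x >] then frag_derive f c (frag_inv c x) else 0.

Definition frag_speed c (x : X) : R :=
  if `[< frag_image c x >] then metric_differential c (frag_inv c x) else 0.

End fragment_differentials.

Section alberti.
Context {R : realType} {X : completeMetricType R}.
Variable mu : {measure set (borel X) -> \bar R}.
Local Open Scope ereal_scope.

Record alberti_representation := AlbertiRepresentation {
  ar_base : fragment X ;
  ar_prob : probability (borel (fragment_at ar_base)) R ;
  ar_meas : fragment X -> {finite_measure set (borel X) -> \bar R} ;
  ar_regular : regular ar_prob ;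
  ar_dominates : forall c,
    (ar_meas c : set (borel X) -> \bar R) `<<
      (fun A : set (borel X) => hausdorff1 ((A : set X) `&` frag_image c)) ;
  ar_measurable_Cc : forall g : X -> R,
    continuous g -> compact (closure [set x | g x != 0%R]) ->
    measurable_fun setT (fun c : borel (fragment_at ar_base) =>
      \int[ar_meas c]_x (g x)%:E) ;
  ar_disintegration : forall A : set (borel X), measurable A ->
    mu A = \int[ar_prob]_c ar_meas c A ;
  ar_measurable_arc : forall (A : set (borel X)) (a b : R),
    measurable A -> (a <= b)%R ->
    measurable_fun setT (fun c : borel (fragment_at ar_base) =>
      ar_meas c (A `&` [set c t | t in fdom c `&` `[a, b]]))
}.

Implicit Types A : alberti_representation.

Definition ar_lipschitz A : Prop :=
  exists C : R, {ae ar_prob A, forall c, frag_lipschitz C c}.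

Definition ar_speed_ge A (f delta : X -> R) : Prop :=
  {ae ar_prob A, forall c : fragment X,
    {ae lebesgue_measure, forall t : R, fdom c t ->
      (frag_derive f c t >= delta (c t) * metric_differential c t)%R}}.

Definition is_alberti_derivation A (D : (X -> R) -> (X -> R)) : Prop :=
  is_derivation mu D /\
  forall (f : X -> R) (g : borel X -> R), lipb f ->
    measurable_fun setT g -> (exists M : R, forall x, (`|g x| <= M)%R) ->
    mu.-integrable setT (EFin \o g) ->
    \int[mu]_x (g x * D f x)%:E =
    \int[ar_prob A]_c \int[ar_meas A c]_x (g x * frag_partial f c x)%:E.

Definition ar_speed_measure A (B : set (borel X)) : \bar R :=
  \int[ar_prob A]_c \int[ar_meas A c]_(x in B) (frag_speed c x)%:E.

Definition is_effective_speed A (sigma : X -> R) : Prop :=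
  measurable_fun setT (sigma : borel X -> R) /\
  forall B : set (borel X), measurable B ->
    ar_speed_measure A B = \int[mu]_(x in B) (sigma x)%:E.

End alberti.

(* Main.v *)
Require Import Defs.
From HB Require Import structures.
From mathcomp Require Import all_boot all_order all_algebra.
From mathcomp Require Import all_classical all_reals all_analysis.
From mathcomp Require Import measurable_realfun.
From mathcomp Require Import lra.
Import Order.TTheory GRing.Theory Num.Theory.
Import numFieldNormedType.Exports.
Local Open Scope classical_set_scope.
Local Open Scope ring_scope.

(** Both sides of the inequality are densities with respect to [mu] of iterated
    integrals over the fragments of the representation: [D_A f] of the
    derivative of [f] along the fragments, and the effective speed of their
    metric derivative. On the set where [delta >= a], with [a > 0] constant,
    the speed condition bounds the first integrand below by [a] times the
    second one. Hence [a * sigma <= Df] almost everywhere on [a <= delta]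
    ([ae_effective_speed_le]); since [sigma >= 0] almost everywhere
    ([effective_speed_ae_ge0]), letting [a] run through the positive rationals
    below [delta x] gives the theorem.

    The bound on the integrands is known for almost every parameter [t] and is
    needed for almost every point [x] of the image. The transfer
    ([ae_fdom_ae_image]) works because a fragment, being Lipschitz, maps
    Lebesgue null sets to sets without length, which are null for the measures
    of the representation.

    The comparison of densities is tested on compact sets [K]. Inner regularity
    makes this enough: the set where the inequality fails is null as soon as
    all its compact subsets are ([compact_null_null]). Compactness of [K] is
    what relates the extension [Df] to the derivation itself: [f] is bounded
    near [K], so that it coincides there with a bounded Lipschitz function [h]
    ([lipschitz_truncation]). The functions [h] and [f] agree on an open set
    containing [K], not only on [K]; thus they have the same derivative at every
    parameter that a fragment sends to [K].

    The integrands [frag_partial h c] and [frag_speed c], and the inner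
    integrals as functions of the fragment [c], are not known to be measurable.
    The integral of an arbitrary nonnegative function is the supremum of the
    integrals of the simple functions below it, a lower integral. It is
    still monotone up to null sets and positively homogeneous
    ([ae_le_lower_integral], [ge0_lower_integralZl]), and the iterated integrals
    are compared by these two properties alone. *)

Set Implicit Arguments.
Unset Strict Implicit.
Unset Printing Implicit Defensive.

(** * Integrals of possibly non-measurable functions *)

Section lower_integral.
Context d (T : measurableType d) (R : realType).
Variable mu : {measure set T -> \bar R}.
Implicit Types (P Q : T -> Prop) (f g : T -> \bar R) (D : set T).
Import HBNNSimple.

Lemma ae_imply P Q : (forall x, P x -> Q x) ->
  {ae mu, forall x, P x} -> {ae mu, forall x, Q x}.
Proof. exact: filterS. Qed.

Lemma ae_forall_countable (I : countType) (P : I -> T -> Prop) :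
  (forall i, {ae mu, forall x, P i x}) -> {ae mu, forall x i, P i x}.
Proof.
move=> aeP.
have : {ae mu, forall x (k : nat) i, unpickle k = Some i -> P i x}.
  apply: (@ae_foralln _ _ _ mu (fun k x => forall i, unpickle k = Some i -> P i x)).
  move=> k; case: (unpickle k) => [i|]; last exact: aeW.
  by apply: ae_imply (aeP i) => x Pix _ [<-].
by apply: ae_imply => x Px i; apply: (Px (pickle i)); rewrite pickleK.
Qed.

(** Cutting a simple function below [f] by the indicator of the complement of
    the exceptional set puts it below [g] without changing its integral. *)
Lemma ae_ge0_le_lower_integral f g :
  (forall x, 0 <= f x)%E -> (forall x, 0 <= g x)%E ->
  {ae mu, forall x, (f x <= g x)%E} ->
  (\int[mu]_x f x <= \int[mu]_x g x)%E.
Proof.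
move=> f0 g0 [N [mN N0 fgN]].
rewrite ge0_integralTE// ge0_integralTE//.
apply: ge_ereal_sup => _ [/= h hf <-].
have mCN : measurable (~` N) by exact: measurableC.
pose h' := proj_nnsfun h mCN.
have h'E x : h' x = h x * (x \in ~` N)%:R by rewrite /= mindicE.
apply: (@le_trans _ _ (sintegral mu h')).
  rewrite -!integralT_nnsfun.
  have mh (k : {nnsfun T >-> R}) : measurable_fun setT (EFin \o k).
    exact/measurable_EFinP.
  rewrite (@ae_eq_integral _ _ _ mu setT _ _ measurableT (mh h) (mh h'))//.
  exists N; split=> // x; apply: contra_notP => Nx _ /=.
  by rewrite mindicE mem_set// mulr1.
apply: ereal_sup_ubound; exists h' => // x; rewrite h'E.
have [xN|xN] := boolP (x \in ~` N); last by rewrite mulr0.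
rewrite mulr1 (le_trans (hf x))//.
by move: xN; rewrite inE; apply: contra_notP => ?; exact: fgN.
Qed.

Lemma ae_le_lower_integral D f g :
  {ae mu, forall x, D x -> (f x <= g x)%E} ->
  (\int[mu]_(x in D) f x <= \int[mu]_(x in D) g x)%E.
Proof.
move=> fg; rewrite integral_mkcond [leRHS]integral_mkcond.
rewrite integralE [leRHS]integralE.
have fgD : {ae mu, forall x, ((f \_ D) x <= (g \_ D) x)%E}.
  apply: ae_imply fg => x; rewrite /patch; case: ifPn => // + -> //.
  by rewrite inE.
apply: leeB; apply: ae_ge0_le_lower_integral => //; apply: ae_imply fgD => x fgx.
  by apply: (@funepos_le _ _ [set x]) => [y /set_mem ->|]; rewrite ?inE.
by apply: (@funeneg_le _ _ [set x]) => [y /set_mem ->|]; rewrite ?inE.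
Qed.

Lemma ge0_lower_integralZl D f (k : R) :
  0 < k -> (forall x, D x -> (0 <= f x)%E) ->
  (\int[mu]_(x in D) (k%:E * f x) = k%:E * \int[mu]_(x in D) f x)%E.
Proof.
have ge_half (r : R) h : 0 < r -> (forall x, 0 <= h x)%E ->
    (r%:E * \int[mu]_x h x <= \int[mu]_x (r%:E * h x))%E.
  move=> r0 h0; rewrite !ge0_integralTE//; last first.
    by move=> x; rewrite mule_ge0// lee_fin ltW.
  rewrite -ereal_sup_pZl//; apply: ge_ereal_sup => _ [_ [g /= gh <-] <-].
  rewrite -sintegralrM; apply: ereal_sup_ubound.
  exists (scale_nnsfun g (ltW r0)) => //= x.
  by rewrite EFinM lee_pmul2l.
move=> k0 f0; rewrite integral_mkcond erestrict_scale [in RHS]integral_mkcond.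
set h := f \_ D.
have {f0} h0 x : (0 <= h x)%E by exact: erestrict_ge0.
apply/eqP; rewrite eq_le ge_half// andbT -lee_pdivrMl//.
(* The reverse inequality is the first one for k^-1 and k * h. *)
have kh0 x : (0 <= k%:E * h x)%E by rewrite mule_ge0// lee_fin ltW.
apply: le_trans (ge_half k^-1 _ _ kh0) _; first by rewrite invr_gt0.
under eq_integral do rewrite muleA -EFinM mulVf ?gt_eqF// mul1e.
by [].
Qed.

Lemma lt0_integral_ge0_null D (u : T -> R) :
  measurable D -> measurable_fun D u -> (forall x, D x -> u x < 0) ->
  (0 <= \int[mu]_(x in D) (u x)%:E)%E -> mu D = 0%E.
Proof.
move=> mD u_meas u0 intu.
have : (\int[mu]_(x in D) `|(u x)%:E| = 0)%E.
  apply/eqP; rewrite eq_le integral_ge0// andbT.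
  rewrite -oppe_ge0 -integral_ge0N//.
  rewrite (@eq_integral _ _ _ mu D (fun x => (u x)%:E))// => x.
  by rewrite inE => Dx; rewrite /= ltr0_norm ?u0// opprK.
have mEu : measurable_fun D (EFin \o u) by exact/measurable_EFinP.
move=> /(ae_eq_integral_abs _ mD mEu) u_eq0; apply/(negligibleP _ mD).
apply: negligibleS u_eq0 => x Dx /= /(_ Dx)[ux0].
by have := u0 _ Dx; rewrite ux0 ltxx.
Qed.

End lower_integral.

(** * Radon measures and compact sets *)

Section compact_sets.
Context (R : realType) (X : completeMetricType R).
Implicit Types K : set X.

Lemma compact_borel K : compact K -> measurable (K : set (borel X)).
Proof.
move=> cK; rewrite -[K]setCK; apply: measurableC; apply: sub_sigma_algebra.
by rewrite /= openC; apply: compact_closed => //; exact: metric_hausdorff.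
Qed.

Lemma locally_finite_compact (mu : {measure set (borel X) -> \bar R}) K :
  locally_finite mu -> compact K -> (mu K < +oo)%E.
Proof.
move=> lfmu /[dup] /compact_borel mK; rewrite compact_cover => cK.
have /choice[U HU] := lfmu.
have mU x : measurable (U x : set (borel X)).
  by apply: sub_sigma_algebra; have [] := HU x.
have [D _] : finite_subset_cover [set: X] U K.
  apply: cK => [x _|x Kx]; first by have [] := HU x.
  by exists x => //; have [] := HU x.
set C := cover _ U => KC.
have [mC muC] : measurable (C : set (borel X)) /\ (mu C < +oo)%E.
  rewrite /C /cover bigcup_fset.
  elim/big_ind : _ => [|A B [mA muA] [mB muB]|x _].
  - by rewrite measure0; split => //; exact: measurable0.
  - split; first exact: measurableU.
    by apply: le_lt_trans (measureU2 mu mA mB) _; exact: lte_add_pinfty.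
  - by split => //; have [] := HU x.
apply: le_lt_trans muC.
exact: (@le_measure _ _ _ mu K _ (mem_set mK) (mem_set mC) KC).
Qed.

Lemma compact_null_null (mu : {measure set (borel X) -> \bar R})
    (E : set (borel X)) : inner_regular mu -> measurable E ->
  (forall K, compact K -> K `<=` (E : set X) -> mu K = 0%E) -> mu E = 0%E.
Proof.
move=> irmu mE E0; apply/eqP; rewrite eq_le measure_ge0 andbT irmu//.
by apply: ge_ereal_sup => _ [K [cK KE] <-]; rewrite E0.
Qed.

End compact_sets.

(** * Bounded truncations of Lipschitz functions *)

Section lipschitz.
Context (R : realType) (X : metricType R).
Implicit Type f : X -> R.

Lemma lipschitz_continuous f : lipschitz_fun f -> continuous f.
Proof.
move=> [L fL] x; apply/cvgrPdist_le => e e0.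
have L0 : 0 < `|L| + 1 by rewrite ltr_wpDl.
near=> y; apply: le_trans (fL _ _) _.
apply: (@le_trans _ _ ((`|L| + 1) * mdist x y)).
  apply: ler_wpM2r; first exact: mdist_ge0.
  by rewrite (le_trans (ler_norm L))// lerDl.
rewrite -ler_pdivlMl// mulrC; apply: ltW.
have : ball x (e / (`|L| + 1)) y.
  by near: y; apply: nbhsx_ballx; rewrite divr_gt0.
by rewrite ballEmdist.
Unshelve. all: by end_near. Qed.

(** Truncating one unit above the bound of [f] on [K] makes the truncation
    agree with [f] on a neighbourhood of [K], hence keeps its derivatives. *)
Lemma lipschitz_truncation f (K : set X) : lipschitz_fun f -> compact K ->
  exists h U, [/\ lipb h, open U, K `<=` U & {in U, f =1 h}].
Proof.
move=> fL cK; have cf := lipschitz_continuous fL.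
have [M0 [_ fM]] := compact_bounded
  (continuous_compact (continuous_subspaceT cf) cK).
pose M : R := `|M0| + 1.
have M0M : M0 < M by rewrite (le_lt_trans (ler_norm _))// ltrDl.
have Mge0 : 0 <= M by rewrite addr_ge0.
exists (fun x => Num.max (- (M + 1)) (Num.min (M + 1) (f x))),
  (f @^-1` `](- (M + 1)), (M + 1)[%classic); split.
- split.
    exists (M + 1) => x; rewrite ler_norml le_max lexx/= ge_max.
    by rewrite ge_min lexx andbT ge0_cp// addr_ge0.
  have [L fL'] := fL; exists L => x y; apply: le_trans (fL' x y).
  wlog fxy : x y / f x <= f y.
    move=> H; have [/H//|/ltW/H] := leP (f x) (f y).
    by rewrite distrC [leRHS]distrC.
  rewrite [leRHS]ler0_norm ?subr_le0// ler_norml !maxElt !minElt.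
  case: (ltP (M + 1) (f x)) => ?; case: (ltP (M + 1) (f y)) => ?;
    do 2![case: ltP => ?]; apply/andP; split; lra.
- by move/continuousP: cf; apply; exact: itv_open.
- move=> x Kx /=; have := fM M M0M (f x); rewrite in_itv/= -ltr_norml.
  by move=> fxM; rewrite (le_lt_trans (fxM _)) ?ltrDl//; exists x.
- move=> x /set_mem/=; rewrite in_itv/= => /andP[/ltW Mf /ltW fM1].
  by rewrite (min_idPr fM1) (max_idPr Mf).
Qed.

End lipschitz.

(** * Sets of zero length *)

Section hausdorff_null.
Context (R : realType) (X : metricType R).
Implicit Types E G : set X.

Lemma diam_ge0 E : (0 <= diam E)%E.
Proof. by apply: ereal_sup_ubound; left. Qed.

Lemma diam_le E (r : R) :
  0 <= r -> (forall x y, E x -> E y -> mdist x y <= r) -> (diam E <= r%:E)%E.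
Proof.
move=> r0 Er; apply: ge_ereal_sup => _ [->|[[x y] [/= Ex Ey] <-]].
  by rewrite lee_fin.
by rewrite lee_fin; exact: Er.
Qed.

(** A cover whose diameters have a small sum consists of small sets, which
    takes care of the mesh condition in the Hausdorff measure. *)
Lemma hausdorff1_eq0 G :
  (forall n, exists E : (set X)^nat, G `<=` \bigcup_k E k /\
    (\sum_(0 <= k <oo) diam (E k) <= (n.+1%:R^-1 : R)%:E)%E) ->
  hausdorff1 G = 0%E.
Proof.
move=> GE; apply/eqP; rewrite eq_le; apply/andP; split.
  apply: ge_ereal_sup => _ [d /= d0 <-]; apply/lee_addgt0Pr => e e0.
  have m0 : 0 < Num.min d e by rewrite lt_min d0.
  have [n _ /(_ n (leqnn n))/= nde] := near_infty_natSinv_lt (PosNum m0).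
  move: nde; rewrite lt_min => /andP[/ltW nd /ltW ne].
  have [E [GEk sE]] := GE n; rewrite add0e.
  apply: (@le_trans _ _ (\sum_(0 <= k <oo) diam (E k))%E); last first.
    by apply: le_trans sE _; rewrite lee_fin.
  apply: ereal_inf_lbound; exists E => //; split => // k.
  rewrite -lee_fin in nd; apply: le_trans nd; apply: le_trans sE.
  have := @nneseries_lim_ge _ (diam \o E) xpredT 0 k.+1
    (fun _ _ _ => diam_ge0 _).
  apply: le_trans; rewrite big_nat_recr//= leeDr//.
  by apply: sume_ge0 => i _; exact: diam_ge0.
apply: (@le_trans _ _ (hausdorff1_premeasure 1 G)).
  apply: le_ereal_inf_tmp => _ [E _ <-]; apply: nneseries_ge0 => k _ _.
  exact: diam_ge0.
by apply: ereal_sup_ubound; exists 1 => //=.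
Qed.

End hausdorff_null.

Lemma null_set_itv_cover (R : realType) (N : set R) (e : R) :
  0 < e -> lebesgue_measure.-negligible N ->
  exists F : nat -> R * R, [/\ forall k, (F k).1 <= (F k).2,
    N `<=` \bigcup_k `[(F k).1, (F k).2]%classic &
    (\sum_(0 <= k <oo) ((F k).2 - (F k).1)%:E <= e%:E)%E].
Proof.
move=> e0 /negligible_outer_measure N0.
have : ((wlength idfun)^*%mu N < e%:E)%E by rewrite N0 lte_fin.
move=> /ereal_inf_lt[_ [I [mI NI] <-] Ie].
have {mI} /choice[F IF] k : exists x : R * R, [/\ x.1 <= x.2,
    I k `<=` `[x.1, x.2]%classic & (x.2 - x.1)%:E = wlength idfun (I k)].
  have [Ik|[x xlt Ik]] := (ocitvP (I k)).1 (mI k).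
    by exists (0, 0); rewrite Ik wlength0 subrr; split.
  exists x; rewrite Ik; split; first exact: ltW.
    by move=> t /=; rewrite !in_itv/= => /andP[/ltW -> ->].
  by rewrite wlength_itv_bnd ?(ltW xlt).
exists F; split.
- by move=> k; have [] := IF k.
- by move=> x /NI[k _ Ikx]; exists k => //; have [_ + _] := IF k; apply.
- apply: le_trans (ltW Ie); apply: lee_nneseries => k *.
    by rewrite lee_fin subr_ge0; have [] := IF k.
  by have [_ _ ->] := IF k.
Qed.

(** * Differentiation along a fragment *)

Section fragment_calculus.
Context (R : realType) (X : completeMetricType R) (c : fragment X).

Lemma fragment_within_continuous : {within fdom c, continuous c}.
Proof.
have [l [L [_ L0 cL]]] := frag_bilipschitz c.
apply/subspace_continuousP => s cs; apply/cvg_ballP => e e0.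
have eL0 : 0 < e / L by rewrite divr_gt0.
rewrite near_withinE; apply: filterS (nbhsx_ballx s _ eL0) => t st ct.
rewrite ballEmdist/=.
have /andP[_ /le_lt_trans->//] := cL _ _ cs ct.
by rewrite mulrC -ltr_pdivlMr.
Qed.

(** The image of [N] is covered by the images of intervals covering [N]. Closed
    intervals are used so that these images are compact: the set [G] built from
    them is then Borel. *)
Lemma fragment_null_image (N : set R) : lebesgue_measure.-negligible N ->
  exists2 G : set (borel X), measurable G &
    c @` (fdom c `&` N) `<=` G /\
    forall G' : set X, G' `<=` (G : set X) -> hausdorff1 G' = 0%E.
Proof.
move=> N0.
have [l [L [_ L0 cL]]] := frag_bilipschitz c.
have en0 n : 0 < n.+1%:R^-1 / L by rewrite divr_gt0.
have /choice[F NF] n := null_set_itv_cover (en0 n) N0.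
pose E n k : set X := c @` (fdom c `&` `[(F n k).1, (F n k).2]%classic).
exists (\bigcap_n \bigcup_k E n k : set X); last split.
- apply: bigcap_measurable => // n _; apply: bigcup_measurable => k _.
  apply: compact_borel; apply: continuous_compact.
    apply: continuous_subspaceW fragment_within_continuous.
    by move=> t [].
  by apply: compact_closedI; [exact: fdom_compact|exact: itv_closed].
- move=> _ [t [ct Nt] <-] n _; have [_ /(_ _ Nt)[k _ tk] _] := NF n.
  by exists k => //; exists t.
- move=> G' G'G; apply: hausdorff1_eq0 => n; exists (E n); split.
    by move=> x /G'G/(_ n); exact.
  have [F12 _ sF] := NF n.
  apply: (@le_trans _ _
      (\sum_(0 <= k <oo) (L%:E * ((F n k).2 - (F n k).1)%:E))%E).
    apply: lee_nneseries => [k _ _|k _]; first exact: diam_ge0.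
    apply: diam_le; first by rewrite mulr_ge0 ?subr_ge0// ltW.
    move=> _ _ [s [cs sk] <-] [t [ct tk] <-].
    have /andP[_ /le_trans->//] := cL _ _ cs ct.
    rewrite ler_pM2l//; move: sk tk; rewrite /= !in_itv/=.
    by move=> /andP[? ?] /andP[? ?]; rewrite ler_norml; apply/andP; split; lra.
  rewrite nneseriesZl; last by move=> *; rewrite lee_fin subr_ge0.
  by rewrite -lee_pdivlMl// -EFinM mulrC.
Qed.

Lemma frag_lim_ge0 (q : R -> R) (t : R) :
  (forall s, 0 <= q s) -> 0 <= frag_lim c q t.
Proof.
move=> q0; rewrite /frag_lim; case: asboolP => // -[ct cvq].
have FF : ProperFilter (within (fdom c) t^').
  apply: Build_ProperFilter_ex => B; rewrite /within/= => tB.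
  by have [s [st cs Bs]] := ct _ tB; exists s; exact: Bs.
by apply: limr_ge => //; exact: nearW.
Qed.

Lemma eq_frag_lim (q1 q2 : R -> R) (t : R) :
  (\forall s \near t, fdom c s -> q1 s = q2 s) ->
  frag_lim c q1 t = frag_lim c q2 t.
Proof.
move=> q12; rewrite /frag_lim.
suff -> : q1 @ within (fdom c) t^' = q2 @ within (fdom c) t^' by [].
by apply/seteqP; split => B; rewrite /nbhs/= /within/=; apply: filterS2 q12;
  move=> s q12 + st cs => /(_ st cs); rewrite /preimage/= q12.
Qed.

(** A fragment is continuous along its domain, so [f] and [g] agree at [c s] for
    the parameters [s] close to [t]. *)
Lemma frag_derive_local (f g : X -> R) (U : set X) (t : R) :
  open U -> {in U, f =1 g} -> fdom c t -> U (c t) ->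
  frag_derive f c t = frag_derive g c t.
Proof.
move=> oU fg ct Uct; apply: eq_frag_lim.
have /subspace_continuousP/(_ _ ct) cc := fragment_within_continuous.
have {cc} : \forall s \near within (fdom c) (nbhs t), U (c s).
  exact: (cc U (open_nbhs_nbhs (conj oU Uct))).
rewrite near_withinE; apply: filterS => s + cs => /(_ cs) Ucs.
by rewrite !fg// inE.
Qed.

Lemma frag_invK x :
  frag_image c x -> fdom c (frag_inv c x) /\ c (frag_inv c x) = x.
Proof.
move=> [t ct cx].
by apply: (@xgetPex _ 0 [set t | fdom c t /\ c t = x]); exists t.
Qed.

Lemma frag_partial_local (f g : X -> R) (U : set X) x :
  open U -> {in U, f =1 g} -> U x -> frag_partial f c x = frag_partial g c x.
Proof.
move=> oU fg Ux; rewrite /frag_partial; case: asboolP => // /frag_invK[ct cx].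
by apply: (frag_derive_local oU fg ct); rewrite cx.
Qed.

Lemma frag_speed_ge0 x : 0 <= frag_speed c x.
Proof.
rewrite /frag_speed; case: asboolP => // _; apply: frag_lim_ge0 => s.
by rewrite divr_ge0// mdist_ge0.
Qed.

(** The exceptional parameters form a null set, whose image lies in a Borel set
    without length. *)
Lemma ae_fdom_ae_image (nu : {measure set (borel X) -> \bar R})
    (Q : R -> Prop) :
  (nu : set (borel X) -> \bar R) `<<
    (fun A : set (borel X) => hausdorff1 ((A : set X) `&` frag_image c)) ->
  {ae lebesgue_measure, forall t : R, fdom c t -> Q t} ->
  {ae nu, forall x, frag_image c x -> Q (frag_inv c x)}.
Proof.
move=> nuH /fragment_null_image[G mG [cG G0]]; exists G; split => //.
  by apply: (nuH G) => //= B mB BG; apply: G0 => x [Bx _]; exact: BG.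
move=> x /= /not_implyP[xc nQ]; apply: cG; have [ct cx] := frag_invK xc.
by exists (frag_inv c x) => //; split=> // /(_ ct).
Qed.

End fragment_calculus.

(** * Comparison of the derivation with the effective speed *)

Section speed_comparison.
Context (R : realType) (X : completeMetricType R).
Variables (mu : {measure set (borel X) -> \bar R}).
Variable A : alberti_representation mu.

Lemma ae_frag_partial_ge (f delta : X -> R) : ar_speed_ge A f delta ->
  {ae ar_prob A, forall c : fragment X, {ae ar_meas A c, forall x,
    delta x * frag_speed c x <= frag_partial f c x}}.
Proof.
apply: (@ae_imply _ _ _ (ar_prob A)) => c.
move=> /(ae_fdom_ae_image (@ar_dominates _ _ _ A c)).
apply: (@ae_imply _ _ _ (ar_meas A c)) => x.
rewrite /frag_speed /frag_partial => xc.
(* Off the image of c both sides vanish. *)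
case: asboolP => [cx|_]; last by rewrite mulr0.
by have := xc cx; rewrite (frag_invK cx).2.
Qed.

Lemma speed_measure_le (f delta : X -> R) (U K : set X) (h : X -> R) (a : R) :
  ar_speed_ge A f delta -> 0 < a -> (forall x, K x -> a <= delta x) ->
  open U -> K `<=` U -> {in U, f =1 h} ->
  (a%:E * ar_speed_measure A K <=
   \int[ar_prob A]_c \int[ar_meas A c]_x (\1_K x * frag_partial h c x)%:E)%E.
Proof.
move=> /ae_frag_partial_ge Af a0 Ka oU KU fh; rewrite /ar_speed_measure.
rewrite -ge0_lower_integralZl//; last first.
  by move=> c _; apply: integral_ge0 => x _; rewrite lee_fin frag_speed_ge0.
apply: ae_le_lower_integral; apply: (ae_imply _ Af) => c cf _.
rewrite -ge0_lower_integralZl//; last first.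
  by move=> x _; rewrite lee_fin frag_speed_ge0.
rewrite integral_mkcond; apply: ae_le_lower_integral.
apply: (ae_imply _ cf) => x + _.
rewrite patchE indicE; case: ifPn => [|_ _]; last by rewrite mul0r.
rewrite inE => Kx; rewrite mul1r -EFinM lee_fin.
rewrite -(frag_partial_local _ oU fh (KU _ Kx)).
by apply: le_trans; rewrite ler_wpM2r ?frag_speed_ge0 ?Ka.
Qed.

Variables (sigma : X -> R) (sigma_A : is_effective_speed A sigma).

(** On the set where [sigma] is negative, its integral is a value of the speed
    measure, which is nonnegative. *)
Lemma effective_speed_ae_ge0 : {ae mu, forall x, 0 <= sigma x}.
Proof.
have [msigma sigmaE] := sigma_A.
pose B : set (borel X) := [set x | sigma x < 0].
have mB : measurable B.
  rewrite (_ : B = sigma @^-1` `]-oo, 0[); last first.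
    by apply/seteqP; split => x /=; rewrite in_itv.
  by rewrite -[X in measurable X]setTI; exact: msigma.
have B0 : mu B = 0%E.
  apply: (@lt0_integral_ge0_null _ _ _ mu B sigma) => //.
    exact: measurable_funTS.
  rewrite -sigmaE//; apply: integral_ge0 => c _; apply: integral_ge0 => x _.
  by rewrite lee_fin frag_speed_ge0.
by exists B; split => // x /= /negP; rewrite -ltNge.
Qed.

Variables (f delta : X -> R) (D : (X -> R) -> (X -> R)) (Df : X -> R).
Hypotheses (f_lip : lipschitz_fun f) (A_speed : ar_speed_ge A f delta).
Hypotheses (D_A : is_alberti_derivation A D).
Hypothesis D_f : derivation_extension mu D f Df.

(** The definition of [D_A], tested against the indicator of [K], turns the
    right-hand side into an iterated integral of the derivative along fragments
    of a bounded truncation of [f]. *)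
Lemma effective_speed_integral_le (a : R) (K : set X) :
  compact K -> (mu K < +oo)%E -> 0 < a -> (forall x, K x -> a <= delta x) ->
  (a%:E * \int[mu]_(x in K) (sigma x)%:E <= \int[mu]_(x in K) (Df x)%:E)%E.
Proof.
move=> cK muK a0 Ka; have mK := compact_borel cK.
have [h [U [lh oU KU fh]]] := lipschitz_truncation f_lip cK.
have Dh : {ae mu, forall x, K x -> Df x = D h x}.
  by apply: D_f.2 cK lh _ => x; rewrite inE => /KU Ux; rewrite fh ?inE.
rewrite -sigma_A.2//; apply: le_trans (speed_measure_le A_speed a0 Ka oU KU fh) _.
have m1K : measurable_fun setT (\1_(K : set (borel X)) : borel X -> R).
  exact: measurable_indic.
rewrite -(D_A.2 h (\1_(K : set (borel X)) : borel X -> R))//; last 2 first.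
- by exists 1 => x; rewrite indicE ger0_norm// lern1 leq_b1.
- apply/integrableP; split; first exact/measurable_EFinP.
  under eq_integral do rewrite /= ger0_norm ?indicE//.
  by have := @integral_indic _ _ _ mu _ measurableT _ mK; rewrite setIT => ->.
rewrite [leRHS]integral_mkcond; apply: ae_le_lower_integral.
apply: (ae_imply _ Dh) => x Kx _; rewrite patchE indicE; case: ifPn => [|_].
  by rewrite inE => /Kx <-; rewrite mul1r.
by rewrite mul0r.
Qed.

Hypotheses (mu_radon : radon mu).
Hypothesis delta_borel : measurable_fun setT (delta : borel X -> R).

(** Restricting to the points where [Df] and [sigma] are bounded by [n] makes
    both integrable on compact sets, so that their integrals can be
    subtracted. *)
Lemma ae_effective_speed_le (a : R) : 0 < a ->
  {ae mu, forall x, a <= delta x -> a * sigma x <= Df x}.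
Proof.
move=> a0; have [lfmu irmu] := mu_radon.
have mDf := D_f.1; have msigma := sigma_A.1.
pose E n : set (borel X) := [set x | [/\ a <= delta x, Df x < a * sigma x,
  `|Df x| <= n%:R & `|sigma x| <= n%:R] ].
have masigma : measurable_fun setT (fun x : borel X => a * sigma x).
  exact: measurable_funM.
have mle (u v : borel X -> R) :
    measurable_fun setT u -> measurable_fun setT v ->
    measurable [set x | u x <= v x].
  move=> u_meas v_meas.
  by rewrite -[X in measurable X]setTI; exact: measurable_fun_le.
have mE n : measurable (E n).
  have -> : E n = [set x | a <= delta x] `&`
      ~` [set x | a * sigma x <= Df x] `&`
      [set x | `|Df x| <= n%:R] `&` [set x | `|sigma x| <= n%:R].
    apply/seteqP; split => x /=.
      by move=> [? + ? ?]; rewrite ltNge => /negP.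
    by move=> [[[? /negP]]]; rewrite -ltNge.
  apply: measurableI; [apply: measurableI; [apply: measurableI|]|].
  - exact: (mle (cst a)).
  - by apply: measurableC; exact: mle.
  - by apply: (mle (fun x => `|Df x|) (cst _)) => //; exact: measurableT_comp.
  - by apply: (mle (fun x => `|sigma x|) (cst _)) => //; exact: measurableT_comp.
have E0 n : mu (E n) = 0%E.
  apply: compact_null_null irmu (mE n) _ => K cK KE.
  have muK := locally_finite_compact lfmu cK; have mK := compact_borel cK.
  have iDf : mu.-integrable K (EFin \o (Df : borel X -> R)).
    apply: measurable_bounded_integrable => //; first exact: measurable_funTS.
    exists n%:R; split => // M nM x /KE[_ _ + _]; move=> /le_trans; apply.
    exact: ltW.
  have isigma : mu.-integrable K (EFin \o (sigma : borel X -> R)).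
    apply: measurable_bounded_integrable => //; first exact: measurable_funTS.
    exists n%:R; split => // M nM x /KE[_ _ _]; move=> /le_trans; apply.
    exact: ltW.
  have iasigma : mu.-integrable K (EFin \o (fun x => a * sigma x)).
    exact: (integrableZl mK a isigma).
  apply: (@lt0_integral_ge0_null _ _ _ mu _ (fun x => Df x - a * sigma x)) => //.
  - by apply: measurable_funTS; exact: measurable_funB.
  - by move=> x /KE[_ + _ _]; rewrite subr_lt0.
  under eq_integral do rewrite EFinB.
  rewrite integralB_EFin// sube_ge0; last by rewrite integrable_fin_num.
  have := integralZl mK isigma a; under eq_integral do rewrite -EFinM.
  move=> ->; apply: effective_speed_integral_le => // x.
  by move=> /KE[].
have : mu.-negligible (\bigcup_n E n).
  by apply: negligible_bigcup => n; apply/(negligibleP _ (mE n))/E0.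
apply: negligibleS => x /= /not_implyP[ax /negP]; rewrite -ltNge => Dfx.
exists (Num.trunc (Num.max `|Df x| `|sigma x|)).+1 => //.
have /ltW := truncnS_gt (Num.max `|Df x| `|sigma x|).
by rewrite ge_max => /andP[].
Qed.

End speed_comparison.

Theorem theorem3p31 (R : realType) (X : completeMetricType R)
    (sepX : separable_space X)
    (mu : {measure set (borel X) -> \bar R}) (mu_radon : radon mu)
    (f : X -> R) (f_lip : lipschitz_fun f)
    (delta : X -> R) (delta_borel : measurable_fun setT (delta : borel X -> R))
    (delta_gt0 : forall x, 0 < delta x)
    (A : alberti_representation mu) (A_lip : ar_lipschitz A)
    (A_speed : ar_speed_ge A f delta)
    (D : (X -> R) -> (X -> R)) (D_A : is_alberti_derivation A D)
    (Df : X -> R) (D_f : derivation_extension mu D f Df)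
    (sigma : X -> R) (sigma_A : is_effective_speed A sigma) :
  {ae mu, forall x, Df x >= delta x * sigma x}.
Proof.
have sigma_ge0 := effective_speed_ae_ge0 sigma_A.
have : {ae mu, forall x (q : rat), 0 < (ratr q : R) ->
    ratr q <= delta x -> ratr q * sigma x <= Df x}.
  apply: ae_forall_countable => q.
  have [q0|q0] := ltP 0 (ratr q : R); last exact: aeW.
  apply: ae_imply (ae_effective_speed_le sigma_A f_lip A_speed D_A D_f mu_radon
    delta_borel q0) => x.
  by move=> + _.
apply: (@filterS2 _ _ (ae_filter_ringOfSetsType mu) _ _ _ _ sigma_ge0).
move=> x sx0 qDf; rewrite leNgt; apply/negP => Dfx.
(* For sigma x = 0 the quotient is 0 by convention and any q in the interval
   still works, since then Df x < 0. *)
have : Num.max 0 (Df x / sigma x) < delta x.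
  rewrite gt_max delta_gt0/=; move: sx0; rewrite le_eqVlt.
  by move=> /predU1P[<-|s0]; rewrite ?invr0 ?mulr0// ltr_pdivrMr.
move=> /rat_in_itvoo[q]; rewrite in_itv/= gt_max.
move=> /andP[/andP[q0 Dq] /ltW qd]; have := qDf q q0 qd.
apply/negP; rewrite -ltNge; move: sx0 Dfx; rewrite le_eqVlt.
move=> /predU1P[<-|s0 _]; first by rewrite !mulr0.
by rewrite -ltr_pdivrMr.
Qed.
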